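(* Let $V$ be a ground set, $f\colon 2^V\to\mathbb{R}_{\ge 0}$ a normalized monotone submodular function, $k\ge1$ an integer budget, $\epsilon\in(0,1)$, and consider an inhomogeneous-decaying data stream. The algorithm HistApprox is $(1/3-\epsilon)$-approximate, i.e., at any time $t$, $$g_t(x_1)\ \ge\ \Big(\tfrac13-\epsilon\Big)\,\mathrm{OPT}_t ,$$ where $x_1$ is the smallest index in the index set $\mathbf{x}_t$ maintained by HistApprox and $g_t(x_1)$ is the value of the solution output by the instance $\mathcal{A}_{x_1}^{(t)}$ (which is the solution HistApprox outputs at time $t$).
   Context: **Stream model.** A data stream is a sequence of elements of a ground set $V$ arriving in chronological order; element $v$ arrives at discrete time $t_v\in\mathbb{N}$ (several elements may arrive at the same time). On arrival $v$ is given an initial lifespan $l(v,t_v)\in\mathbb{N}$, $l(v,t_v)\ge 1$; at time $t\ge t_v$ its remaining lifespan (just ''lifespan'') is $l(v,t)=l(v,t_v)-(t-t_v)$, and $v$ is discarded when this becomes $0$. The set of active elements at time $t$ is $\mathcal{S}_t=\{v\in V: t_v\le t,\ l(v,t)>0\}$. **Problem.** $f\colon 2^V\to\mathbb{R}_{\ge0}$ is submodular ($f(S\cup\{s\})-f(S)\ge f(T\cup\{s\})-f(T)$ for $S\subseteq T\subseteq V$, $s\in V\setminus T$), monotone ($f(S)\le f(T)$ for $S\subseteq T$) and normalized ($f(\emptyset)=0$). Write $\delta(s|S)=f(S\cup\{s\})-f(S)$ and $\mathrm{OPT}_t=\max\{f(S): S\subseteq\mathcal{S}_t,\ |S|\le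 k\}$. **SieveStreaming (parameters $k,\epsilon$).** Processes elements one by one. It keeps $\Delta$, the largest singleton value $f(\{v\})$ seen so far (including the current element), and the set of thresholds $\Theta=\{(1+\epsilon)^i: i\in\mathbb{Z},\ \Delta/(2k)\le(1+\epsilon)^i\le\Delta\}$ (about $\log_{1+\epsilon}2k=O(\epsilon^{-1}\log k)$ of them), updated lazily as $\Delta$ grows; each threshold $\theta$ has a candidate set $C_\theta$, empty when $\theta$ first enters $\Theta$; thresholds leaving the range are deleted. For the current element $v$ and each $\theta\in\Theta$: if $|C_\theta|<k$ and $\delta(v|C_\theta)\ge\theta$, then $v$ is added to $C_\theta$. The output is a candidate set of maximum utility; feeding more elements never decreases the output value (the best candidate set encountered so far is retained). With no thresholds (e.g. $\Delta=0$) the output is $\emptyset$. **HistApprox.** Maintains a finite index set $\mathbf{x}_t=\{x_1<x_2<\cdots\}$ of integers $\ge1$ and, for each $l\in\mathbf{x}_t$, a SieveStreaming instance $\mathcal{A}_l^{(t)}$; $g_t(l)$ denotes the value (under $f$) of the output of $\mathcal{A}_l^{(t)}$ at time $t$. Initially $\mathbf{x}_1=\emptyset$. All active elements are stored. At each time $t=1,2,\dots$, with $V_l^{(t)}$ the set of elements arriving at time $t$ with lifespan $l$: 1. (Data update) For each $l$ with $V_l^{(t)}\ne\emptyset$, run Process$(V_l^{(t)})$: If $l\notin\mathbf{x}_t$: when $l$ has no successor (larger index) in $\mathbf{x}_t$, create a new empty instance $\mathcal{A}_l^{(t)}$; otherwise, with $l_2$ the smallest index in $\mathbf{x}_t$ larger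 than $l$, let $\mathcal{A}_l^{(t)}$ be a copy of $\mathcal{A}_{l_2}^{(t)}$ and feed it all previously processed, still active elements whose current lifespan lies in $[l,l_2)$; then add $l$ to $\mathbf{x}_t$. Next, feed $V_l^{(t)}$ to every $\mathcal{A}_i^{(t)}$ with $i\in\mathbf{x}_t$, $i\le l$. Finally run ReduceRedundancy: for each $i\in\mathbf{x}_t$, find the largest $j>i$ in $\mathbf{x}_t$ with $g_t(j)\ge(1-\epsilon)g_t(i)$ and delete every index $l\in\mathbf{x}_t$ with $i<l<j$ together with its instance. 2. Output $S_t$, the output of $\mathcal{A}_{x_1}^{(t)}$. 3. (Time update) If $x_1=1$, remove index $1$ and its instance. Then shift all remaining: $\mathcal{A}_{x_i-1}^{(t+1)}\gets\mathcal{A}_{x_i}^{(t)}$ and $x_i^{(t+1)}\gets x_i^{(t)}-1$. (If $\mathbf{x}_t=\emptyset$ the output is $\emptyset$ with value $0$.) *)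

(* Defs.v *)
From mathcomp Require Import all_boot all_order all_algebra finmap.
From mathcomp Require Import boolp classical_sets cardinality reals.

Set Implicit Arguments.
Unset Strict Implicit.
Unset Printing Implicit Defensive.

Import Order.TTheory GRing.Theory Num.Theory.

Local Open Scope classical_set_scope.
Local Open Scope fset_scope.
Local Open Scope ring_scope.

Section SetFunctions.
Context {R : realType} {V : choiceType}.
Implicit Type f : set V -> R.

Definition gain f (s : V) (S : set V) : R := f (S `|` [set s])%classic - f S.

Definition submodular f : Prop := forall (S T : set V) (s : V),
  (S `<=` T)%classic -> ~ T s -> gain f s T <= gain f s S.

Definition monotone f : Prop := forall S T : set V,
  (S `<=` T)%classic -> f S <= f T.

Definition normalized f : Prop := f set0 = 0.

Lemma fset_argmax (F : {fset V}) f (P : set {fset V}) (S0 : {fset V}) :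
  P S0 -> (forall S, P S -> S `<=` F) ->
  exists2 M, P M & forall S, P S -> f [set` S] <= f [set` M].
Proof.
move=> P0 PF.
have [M PM MP] : exists2 M, P M &
    forall S, S \in (fpowerset F : seq _) -> P S -> f [set` S] <= f [set` M].
  elim: (fpowerset F : seq _) => [|S s [M PM MP]]; first by exists S0.
  have [[PS lt]|nS] := pselect (P S /\ f [set` M] < f [set` S]).
    exists S => // T; rewrite inE => /orP[/eqP->//|Ts PT].
    exact: le_trans (MP _ Ts PT) (ltW lt).
  exists M => // T; rewrite inE => /orP[/eqP->|/MP//] PS.
  by rewrite leNgt; apply/negP => lt; apply: nS.
by exists M => // S PS; apply: MP => //; rewrite fpowersetE; exact: PF.
Qed.

End SetFunctions.

(* The ground set may be infinite (an unbounded stream), but only finitely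
   many elements arrive at each time.  Time starts at 1. *)
Record stream (V : choiceType) := Stream {
  arrival : V -> nat;
  init_lifespan : V -> nat;
  arrival_gt0 : forall v, (0 < arrival v)%N;
  init_lifespan_gt0 : forall v, (0 < init_lifespan v)%N;
  finite_arrival : forall t, finite_set [set v | arrival v = t]
}.

Section Active.
Context {V : choiceType}.
Implicit Type D : stream V.

(* Truncated subtraction: 0 from the moment of expiry on; only meaningful for
   [arrival D v <= t]. *)
Definition lifespan D (v : V) (t : nat) : nat :=
  (init_lifespan D v - (t - arrival D v))%N.

Definition active D (t : nat) : set V :=
  [set v | (arrival D v <= t)%N /\ (0 < lifespan D v t)%N]%classic.

Definition arrivals D (t l : nat) : set V :=
  [set v | arrival D v = t /\ lifespan D v t = l]%classic.

Lemma finite_active D t : finite_set (active D t).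
Proof.
apply: (@sub_finite_set _ _ (\bigcup_(i in `I_t.+1) [set v | arrival D v = i])).
  by move=> v [vt _]; exists (arrival D v).
by apply: bigcup_finite => // i _; exact: finite_arrival.
Qed.

End Active.

Section Optimum.
Context {R : realType} {V : choiceType}.
Variables (f : set V -> R) (k : nat) (D : stream V).

Definition feasible (t : nat) : set {fset V} :=
  [set S : {fset V} | ([set` S] `<=` active D t)%classic /\ (#|` S| <= k)%N]%classic.

(* The supremum is attained: see [OPT_max]. *)
Definition OPT (t : nat) : R :=
  sup [set f [set` S] | S in feasible t]%classic.

Lemma OPT_max t :
  (exists2 S, feasible t S & OPT t = f [set` S]) /\
  (forall S, feasible t S -> f [set` S] <= OPT t).
Proof.
have F0 : feasible t fset0.
  by split; [move=> v; rewrite /= inE | rewrite cardfs0].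
have [S [SA _]|M FM MP] := @fset_argmax _ _ (fset_set (active D t)) f _ _ F0.
  by apply/fsubsetP => v vS; rewrite in_fset_set ?inE;
    [exact: SA | exact: finite_active].
have -> : OPT t = f [set` M].
  apply/eqP; rewrite eq_le; apply/andP; split.
    by apply: ge_sup => [|_ [S /MP ? <-]//]; exists (f [set` M]), M.
  apply: ub_le_sup; last by exists M.
  by exists (f [set` M]) => _ [S /MP ? <-].
by split; [exists M|].
Qed.

End Optimum.

Section Sieve.
Context {R : realType} {V : choiceType}.
Variables (f : set V -> R) (k : nat) (eps : R).

(* [cand i] is the candidate set of the threshold [(1 + eps) ^ i]; it is empty
   whenever that threshold is not in use.  [best] is the output. *)
Record sieve := Sieve {
  top : R;
  cand : int -> {fset V};
  best : {fset V}
}.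

Definition empty_sieve : sieve := Sieve 0 (fun=> fset0) fset0.

Definition threshold (i : int) : R := (1 + eps) ^ i.

Definition in_use (A : sieve) (i : int) : bool :=
  top A / (2 * k)%:R <= threshold i <= top A.

(* Ties between candidates of maximum utility are broken arbitrarily. *)
Definition feed1 (v : V) (A A' : sieve) : Prop :=
  [/\ top A' = Num.max (top A) (f [set v]%classic),
      forall i, cand A' i =
        (if ~~ in_use A' i then fset0
         else if (#|` cand A i| < k)%N
                 && (threshold i <= gain f v [set` cand A i])
         then v |` cand A i
         else cand A i),
      best A' = best A \/ (exists2 i, in_use A' i & best A' = cand A' i),
      f [set` best A] <= f [set` best A'] &
      forall i, in_use A' i -> f [set` cand A' i] <= f [set` best A']].

Fixpoint feed_seq (s : seq V) (A A' : sieve) : Prop :=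
  if s is v :: s' then exists2 B, feed1 v A B & feed_seq s' B A' else A' = A.

(* The elements of a (finite) set are fed one by one, in an arbitrary order. *)
Definition feed_set (B : set V) (A A' : sieve) : Prop :=
  exists s : seq V, [/\ uniq s, [set` s] = B & feed_seq s A A'].

End Sieve.

Section HistApprox.
Context {R : realType} {V : choiceType}.
Variables (f : set V -> R) (k : nat) (eps : R) (D : stream V).

(* [inst l] is only meaningful for [l] in [idx]. [seen] is the set of all
   elements processed so far; expired ones are filtered out when it is used. *)
Record hist := Hist {
  idx : {fset nat};
  inst : nat -> sieve (R := R) (V := V);
  seen : set V
}.

Definition init_hist : hist := Hist fset0 (fun=> empty_sieve) set0.

Definition g (H : hist) (l : nat) : R := f [set` best (inst H l)].

Definition is_succ (X : {fset nat}) (l l2 : nat) : Prop :=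
  [/\ l2 \in X, (l < l2)%N & forall j, j \in X -> (l < j)%N -> (l2 <= j)%N].

Definition backlog (H : hist) (t l l2 : nat) : set V :=
  [set v | [/\ seen H v, active D t v & (l <= lifespan D v t < l2)%N]]%classic.

Definition create_index (t l : nat) (H H' : hist) : Prop :=
  if l \in idx H then H' = H else
  [/\ idx H' = l |` idx H,
      seen H' = seen H,
      forall i, i \in idx H -> inst H' i = inst H i,
      (forall j, j \in idx H -> (j <= l)%N) -> inst H' l = empty_sieve &
      forall l2, is_succ (idx H) l l2 ->
        feed_set f k eps (backlog H t l l2) (inst H l2) (inst H' l)].

Definition feed_batch (t l : nat) (H H' : hist) : Prop :=
  [/\ idx H' = idx H,
      seen H' = (seen H `|` arrivals D t l)%classic,
      forall i, i \in idx H -> (i <= l)%N ->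
        feed_set f k eps (arrivals D t l) (inst H i) (inst H' i) &
      forall i, i \in idx H -> (l < i)%N -> inst H' i = inst H i].

(* The largest index j > i with g j >= (1 - eps) * g i, and 0 if there is none. *)
Definition reach (H : hist) (X : {fset nat}) (i : nat) : nat :=
  (\max_(j <- X | (i < j)%N && ((1 - eps) * g H i <= g H j)%R) j)%N.

(* An index that has been deleted in the meantime is skipped. *)
Definition prune (H : hist) (X : {fset nat}) (i : nat) : {fset nat} :=
  if i \in X then [fset l in X | ~~ (i < l < reach H X i)%N] else X.

(* The indices are visited in an arbitrary order [s]. *)
Definition reduce_redundancy (H H' : hist) : Prop :=
  exists2 s : seq nat, perm_eq s (idx H) &
    H' = Hist (foldl (prune H) (idx H) s) (inst H) (seen H).

Definition process (t l : nat) (H H' : hist) : Prop :=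
  exists H1 H2, [/\ create_index t l H H1, feed_batch t l H1 H2 &
                    reduce_redundancy H2 H'].

Fixpoint process_seq (t : nat) (ls : seq nat) (H H' : hist) : Prop :=
  if ls is l :: ls' then exists2 H1, process t l H H1 & process_seq t ls' H1 H'
  else H' = H.

(* The lifespans of the elements arriving at time t are treated in an arbitrary
   order [ls]. *)
Definition data_update (t : nat) (H H' : hist) : Prop :=
  exists ls : seq nat,
    [/\ uniq ls, forall l, l \in ls <-> (arrivals D t l !=set0)%classic &
        process_seq t ls H H'].

Definition time_update (H : hist) : hist :=
  Hist [fset x.-1 | x in idx H & x != 1%N] (fun l => inst H l.+1) (seen H).

(* [hist_approx t H]: some execution has state [H] right after the data update
   of time [t], that is, when the solution of time [t] is output. *)
Inductive hist_approx : nat -> hist -> Prop :=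
| HistFirst H : data_update 1 init_hist H -> hist_approx 1 H
| HistNext t H H' : hist_approx t H ->
    data_update t.+1 (time_update H) H' -> hist_approx t.+1 H'.

Definition first_index (H : hist) : nat := head 0%N (sort leq (idx H)).

Definition output_value (H : hist) : R :=
  if idx H == fset0 then 0 else g H (first_index H).

End HistApprox.

(* Main.v *)
(* For a threshold th, a sieve that has processed B satisfies one of: its value
   is at least k th (its candidate set is full, or th has dropped out of the
   range), or its candidate set C has f C at most its value and every element of
   B has gain at most th over C.

   Let x be the smallest index at time t.  Its instance has processed every
   active element of lifespan at least x.  The active elements of lifespan below
   x, if any, had all arrived when x last became the neighbour of a since
   expired index y, and the instance y had then processed them, with
   (1 - eps) g(y) <= g(x).
   Take the largest th at most OPT / (3 k).  If no candidate set is full, the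
   candidate sets C1 of x now and C2 of y then give, for an optimal O,
   f O <= f C1 + f C2 + k th <= g(x) + g(x) / (1 - eps) + f O / 3. *)
Require Import Defs.
From mathcomp Require Import all_boot all_order all_algebra finmap.
From mathcomp Require Import boolp classical_sets cardinality reals.
From mathcomp Require Import zify lra.

Set Implicit Arguments.
Unset Strict Implicit.
Unset Printing Implicit Defensive.

Import Order.TTheory GRing.Theory Num.Theory.

Local Open Scope classical_set_scope.
Local Open Scope ring_scope.

(** Bernoulli's inequality makes the powers of [a] unbounded. Shifting exponents by an [m] with
    [a ^ (- m) <= y] turns the search for [i] into one for a least natural number. *)
Lemma exprz_bracket (R : archiRealFieldType) (a y : R) : 1 < a -> 0 < y ->
  exists i : int, a ^ i <= y < a * a ^ i.
Proof.
move=> a1 y0; have a0 : 0 < a by apply: lt_trans a1.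
have unbounded z : exists n : nat, z < a ^+ n.
  have [n zn] : exists n : nat, z < 1 + (a - 1) *+ n.
    exists (Num.bound `|(z - 1) / (a - 1)|).
    have d0 : 0 < a - 1 by rewrite subr_gt0.
    rewrite -ltrBlDl -mulr_natl -ltr_pdivrMr//.
    exact: le_lt_trans (ler_norm _) (archi_boundP (normr_ge0 _)).
  exists n; apply: lt_le_trans zn _; elim: n => [|n IHn].
    by rewrite expr0 mulr0n addr0.
  have : 1 <= a ^+ n by rewrite exprn_ege1// ltW.
  by rewrite exprS mulrS; nra.
have [m ym] := unbounded y^-1.
have {}ym : a ^ (- m%:Z) <= y.
  by rewrite -invr_expz invf_ple ?posrE ?exprz_gt0// ltW.
have ex_p : exists p : nat, y < a ^ (p%:Z - m%:Z).
  have [n yn] := unbounded y; exists (n + m)%N.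
  by rewrite PoszD addrK.
case: (ex_minnP ex_p) => -[|q]; first by rewrite sub0r ltNge ym.
move=> yq min_q; exists (q%:Z - m%:Z); apply/andP; split.
  by rewrite leNgt; apply/negP => /min_q; rewrite ltnn.
by rewrite -[X in X * _]expr1z -expfzDr ?gt_eqF// addrA -PoszD add1n.
Qed.

(** * Diminishing returns and subadditivity of the set function *)

Section SubmodularFunctions.
Variables (R : realType) (V : choiceType) (f : set V -> R).
Hypotheses (f_normalized : normalized f) (f_monotone : monotone f).
Hypothesis f_submodular : submodular f.

Lemma gain_mem (v : V) (S : set V) : S v -> gain f v S = 0.
Proof.
by move=> Sv; rewrite /gain setUidl ?subrr// => _ ->.
Qed.

(** [submodular] only covers [v] outside [T]; inside [T] the left gain vanishes and monotonicity
    makes the right one nonnegative. *)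
Lemma gain_anti (v : V) (S T : set V) : S `<=` T -> gain f v T <= gain f v S.
Proof.
move=> ST; have [Tv|nTv] := pselect (T v); last exact: f_submodular.
by rewrite gain_mem// subr_ge0; apply: f_monotone => x; left.
Qed.

Lemma gain_set0 (v : V) : gain f v set0 = f [set v].
Proof. by rewrite /gain set0U f_normalized subr0. Qed.

Lemma setU_seq_cons (A : set V) (v : V) (s : seq V) :
  A `|` [set` v :: s] = A `|` [set` s] `|` [set v].
Proof.
apply/seteqP; split=> x /=; rewrite inE.
  by case=> [|/orP[/eqP|]]; auto.
by case=> [[|->]|->]; rewrite ?eqxx ?orbT; auto.
Qed.

Lemma le_sum_gains (C : set V) (s : seq V) (th : R) :
    (forall v, v \in s -> gain f v C <= th) ->
  f (C `|` [set` s]) <= f C + (size s)%:R * th.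
Proof.
elim: s => [|v s IHs] gain_th.
  by rewrite set_nil setU0 mul0r addr0.
have {}IHs := IHs (fun x xs => gain_th x (@mem_behead _ (v :: s) x xs)).
have vC : gain f v (C `|` [set` s]) <= th.
  exact: le_trans (gain_anti _ _) (gain_th _ (mem_head _ _)).
rewrite setU_seq_cons; move: vC; rewrite /gain /= -addn1 natrD mulrDl mul1r.
by lra.
Qed.

Lemma subadditive_seq (A : set V) (s : seq V) :
  f (A `|` [set` s]) <= f A + f [set` s].
Proof.
elim: s => [|v s IHs]; first by rewrite set_nil setU0 f_normalized addr0.
have : gain f v (A `|` [set` s]) <= gain f v [set` s].
  by apply: gain_anti => x; right.
by rewrite -{2}[[set` v :: s]]set0U !setU_seq_cons set0U /gain; lra.
Qed.

End SubmodularFunctions.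

(** * Invariant of a single sieve *)

Section SieveInvariant.
Variables (R : realType) (V : choiceType) (f : set V -> R) (k : nat) (eps : R).
Hypotheses (f_ge0 : forall S, 0 <= f S) (f_normalized : normalized f).
Hypotheses (f_monotone : monotone f) (f_submodular : submodular f).
Hypotheses (k_ge1 : (1 <= k)%N) (eps01 : 0 < eps < 1).

Local Notation threshold := (threshold eps).

Lemma threshold_gt0 i : 0 < threshold i.
Proof. by rewrite exprz_gt0// addr_gt0//; case/andP: eps01. Qed.

(* All that is remembered of a sieve of output value [c] that processed [B]. *)
Definition certifies (B : set V) (c : R) : Prop := forall i,
  k%:R * threshold i <= c \/
  exists2 C : {fset V}, f [set` C] <= c &
    forall v, B v -> gain f v [set` C] <= threshold i.

Lemma certifies_set0 : certifies set0 0.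
Proof. by move=> i; right; exists fset0; rewrite ?set_fset0 ?f_normalized. Qed.

Record sieve_inv (A : sieve (R := R) (V := V)) (B : set V) : Prop := SieveInv {
  top_ge0 : 0 <= top A;
  top_ub : forall v, B v -> f [set v] <= top A;
  top_best : top A <= (1 + eps) * f [set` best A];
  cand_size : forall i, (#|` cand A i|)%:R * threshold i <= f [set` cand A i];
  cand_best : forall i, f [set` cand A i] <= f [set` best A];
  cand_gain : forall i, [\/ threshold i < top A / (2 * k)%:R,
    (k <= #|` cand A i|)%N |
    forall v, B v -> gain f v [set` cand A i] <= threshold i] }.

(** [B] occurs only in upper bounds over its elements, so expired elements can be forgotten even if
    they still sit in candidate sets. *)
Lemma sieve_invS A (B B' : set V) :
  B `<=` B' -> sieve_inv A B' -> sieve_inv A B.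
Proof.
move=> BB' [t0 tB tb cs cb cg]; split=> //; first by move=> v /BB'; exact: tB.
move=> i; have [?|?|gi] := cg i; [exact: Or31|exact: Or32|].
by apply: Or33 => v /BB'/gi.
Qed.

Lemma empty_sieve_inv : sieve_inv empty_sieve set0.
Proof.
split=> //= [|i|i]; rewrite ?set_fset0 ?f_normalized ?mulr0 ?cardfs0 ?mul0r//.
by apply: Or33.
Qed.

Lemma sieve_inv_certifies A B : sieve_inv A B -> certifies B (f [set` best A]).
Proof.
case=> t0 tB tb cs cb cg i; have [ltop|kC|gC] := cg i.
(* [k * threshold i] is below [top A / 2], and [top A] is at most [1 + eps < 2] times the output
   value: this is where the factor 2 in the range of thresholds is used. *)
- left; move: ltop; rewrite ltr_pdivlMr ?ltr0n ?muln_gt0// natrM => ltop.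
  have := f_ge0 [set` best A]; have := threshold_gt0 i.
  by case/andP: eps01; nra.
- left; apply: le_trans (cb i); apply: le_trans (cs i).
  by rewrite ler_wpM2r ?ler_nat// ltW ?threshold_gt0.
- by right; exists (cand A i).
Qed.

Lemma feed1_cand_size v A A' B i : sieve_inv A B -> feed1 f k eps v A A' ->
  (#|` cand A' i|)%:R * threshold i <= f [set` cand A' i].
Proof.
case=> _ _ _ cs _ _ [_ -> _ _ _]; case: ifP => _.
  by rewrite cardfs0 mul0r f_ge0.
case: ifP => // /andP[_ gain_v]; have := cs i; have := threshold_gt0 i.
have -> : [set` (v |` cand A i)%fset] = [set` cand A i] `|` [set v].
  apply/seteqP; split=> x /=; rewrite !inE.
    by move=> /orP[/eqP|]; auto.
  by case=> [->|->]; rewrite ?eqxx ?orbT.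
have : (#|` (v |` cand A i)%fset|)%:R <= 1 + (#|` cand A i|)%:R :> R.
  by rewrite nat1r ler_nat cardfsU1; case: (v \notin _).
by move: gain_v; rewrite /gain; nra.
Qed.

(** If [v] raises [top], the largest threshold not above the new [top] is in use and ends with a
    nonempty candidate set. That set is worth at least the threshold, hence more than the new [top]
    divided by [1 + eps]. *)
Lemma feed1_top_best v A A' B : sieve_inv A B -> feed1 f k eps v A A' ->
  top A' <= (1 + eps) * f [set` best A'].
Proof.
move=> inv fd; have [eps0 eps1] := andP eps01.
have [t' c' _ b' cb'] := fd; have [t0 _ tb _ _ _] := inv.
have [fv|fv] := leP (f [set v]) (top A).
  by rewrite t' max_l//; apply: le_trans tb _; rewrite ler_pM2l//; lra.
have {}t' : top A' = f [set v] by rewrite t' max_r// ltW.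
have v0 := le_lt_trans t0 fv.
have [i /andP[lei ltv]] := @exprz_bracket R (1 + eps) (f [set v]) ltac:(lra) v0.
rewrite -/(threshold i) in lei ltv.
have use_i : in_use k eps A' i.
  rewrite /in_use t' lei andbT ler_pdivrMr ?ltr0n ?muln_gt0// natrM.
  have : 1 <= k%:R :> R by rewrite ler1n.
  by have := threshold_gt0 i; nra.
suff c_gt0 : (0 < #|` cand A' i|)%N.
  have := feed1_cand_size i inv fd; have := cb' i use_i; rewrite t'.
  have : 1 <= (#|` cand A' i|)%:R :> R by rewrite ler1n.
  by have := threshold_gt0 i; nra.
rewrite c' use_i /=; case: ifP => [_|/negbT].
  by rewrite cardfs_gt0; apply/fset0Pn; exists v; rewrite !inE eqxx.
(* A rejection means either a full set, nonempty since [1 <= k], or a gain below the threshold,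
   which is impossible for [v] over the empty set. *)
rewrite negb_and -leqNgt => /orP[|]; first exact: leq_trans.
rewrite cardfs_gt0; apply: contraNneq => ->.
by rewrite set_fset0 gain_set0.
Qed.

Lemma feed1_inv v A A' B : sieve_inv A B -> feed1 f k eps v A A' ->
  sieve_inv A' (B `|` [set v]).
Proof.
move=> inv fd; have [t0 tB tb cs cb cg] := inv; have [t' c' _ b' cb'] := fd.
have top_mono : top A <= top A' by rewrite t' le_max lexx.
have topB' x : (B `|` [set v]) x -> f [set x] <= top A'.
  by rewrite t' le_max => -[/tB ->|->]; rewrite ?lexx ?orbT.
split=> //.
- exact: le_trans top_mono.
- exact: feed1_top_best inv fd.
- by move=> i; exact: feed1_cand_size inv fd.
- move=> i; have [/cb'//|nuse] := boolP (in_use k eps A' i).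
  by rewrite c' nuse set_fset0 f_normalized.
- move=> i; have [use|] := boolP (in_use k eps A' i); last first.
    rewrite negb_and -!ltNge => /orP[?|tlt]; first by apply: Or31.
    (* A threshold above [top A'] has an empty candidate set, over which gains are singleton values.
       It can therefore enter the range later as if it had processed all of [B]. *)
    apply: Or33 => x /topB' xt.
    rewrite c' /in_use (lt_geF tlt) andbF set_fset0 gain_set0//.
    exact: le_trans xt (ltW tlt).
  rewrite c' use /=; have [lti|kC|gC] := cg i.
  + apply: Or31; apply: lt_le_trans lti _.
    by rewrite ler_pM2r// invr_gt0 ltr0n muln_gt0.
  + by apply: Or32; rewrite ltnNge kC.
  + case: ifP => [_|/negbT].
      apply: Or33 => x [Bx|->]; last first.
        by rewrite gain_mem ?ltW ?threshold_gt0//= !inE eqxx.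
      apply: le_trans (gC x Bx); apply: gain_anti => // y /= yC.
      by rewrite !inE yC orbT.
    rewrite negb_and -leqNgt -ltNge => /orP[?|/ltW vg]; first by apply: Or32.
    by apply: Or33 => x [/gC//|->].
Qed.

Lemma feed_set_inv (U : set V) A A' B : sieve_inv A B ->
  feed_set f k eps U A A' ->
  sieve_inv A' (B `|` U) /\ f [set` best A] <= f [set` best A'].
Proof.
move=> inv [s [_ <-]]; elim: s A B inv => [A B inv -> |v s IHs A B inv].
  by rewrite set_nil setU0.
move=> [A1 fd fds]; have [inv' le'] := IHs _ _ (feed1_inv inv fd) fds.
case: fd => _ _ _ le _; split; last exact: le_trans le'.
by apply: sieve_invS inv'; rewrite setU_seq_cons setUAC.
Qed.

End SieveInvariant.

(** * Invariant of the histogram of sieves *)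

Section HistInvariant.
Variables (R : realType) (V : choiceType) (f : set V -> R) (k : nat) (eps : R).
Variable D : stream V.
Hypotheses (f_ge0 : forall S, 0 <= f S) (f_normalized : normalized f).
Hypotheses (f_monotone : monotone f) (f_submodular : submodular f).
Hypotheses (k_ge1 : (1 <= k)%N) (eps01 : 0 < eps < 1).

Local Notation hist := (hist (R := R) (V := V)).
Implicit Types H : hist.

Definition live H (t : nat) : set V := seen H `&` active D t.

Definition live_from H (t i : nat) : set V :=
  [set v | live H t v /\ (i <= lifespan D v t)%N].

(* When [j] is the smallest index this is the set of all live elements that
   the instance [j] has not processed. *)
Definition gap H (t j : nat) : set V :=
  [set v | [/\ live H t v, (lifespan D v t < j)%N &
    forall i, i \in idx H -> (i < j)%N -> (i < lifespan D v t)%N]].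

Record hist_inv (t : nat) H : Prop := HistInv {
  idx_gt0 : forall i, i \in idx H -> (0 < i)%N;
  live_bounded : forall v, live H t v ->
    exists2 j, j \in idx H & (lifespan D v t <= j)%N;
  inst_inv : forall i, i \in idx H ->
    sieve_inv f k eps (inst H i) (live_from H t i);
  (* [c] is the value that a now deleted or expired predecessor of [j] had when
     the indices between them were removed. *)
  gap_cert : forall j, j \in idx H -> exists B c,
    [/\ certifies f k eps B c, (1 - eps) * c <= g f H j & gap H t j `<=` B] }.

Lemma is_succ_exists (X : {fset nat}) (l j : nat) : j \in X -> (l < j)%N ->
  exists l2, is_succ X l l2.
Proof.
move=> jX lj; have ex : exists n, (n \in X) && (l < n)%N.
  by exists j; rewrite jX.
case: (ex_minnP ex) => m /andP[mX lm] min_m; exists m; split=> // i iX li.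
by apply: min_m; rewrite iX.
Qed.

(** With a successor [l2], the new index takes over the predecessor of [l2]: its gap lies in that of
    [l2], whose certificate carries over because feeding never lowers the value. Without one,
    [live_bounded] excludes live elements of lifespan at least [l], so an empty sieve has missed
    nothing. *)
Lemma create_index_inv t l H H' : (0 < l)%N -> hist_inv t H ->
  create_index f k eps D t l H H' ->
  [/\ hist_inv t H', l \in idx H' & seen H' = seen H].
Proof.
move=> l0 inv; rewrite /create_index; case: ifP => [lH ->//|/negbT lH].
case=> idx' seen' old new_max new_succ; have [pos bnd insts gaps] := inv.
have live' : live H' t = live H t by rewrite /live seen'.
have from' i : live_from H' t i = live_from H t i by rewrite /live_from live'.
have gap' j : gap H' t j `<=` gap H t j.
  move=> v [lv vj vi]; split=> //; first by rewrite -live'.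
  by move=> i iH; apply: vi; rewrite idx' !inE iH orbT.
have no_live : (forall j, j \in idx H -> (j <= l)%N) -> live_from H t l = set0.
  move=> max_l; rewrite -subset0 => v [/bnd[j jH vj] lv].
  have jl := leq_trans lv vj; suff E : j = l by rewrite -E jH in lH.
  by apply/eqP; rewrite eqn_leq jl max_l.
have [[l2 succ]|nsucc] := pselect (exists l2, is_succ (idx H) l l2).
- have [l2H ll2 l2_min] := succ.
  have [inv' le'] := feed_set_inv f_ge0 f_normalized f_monotone f_submodular
    k_ge1 eps01 (insts l2 l2H) (new_succ l2 succ).
  split=> //; last by rewrite idx' !inE eqxx.
  split=> [i|v|i|j]; rewrite ?idx' ?live' ?from'.
  + by rewrite !inE => /orP[/eqP->//|/pos].
  + by move=> /bnd[j jH ?]; exists j; rewrite // !inE jH orbT.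
  + rewrite !inE => /orP[/eqP->|iH]; last by rewrite old//; exact: insts.
    apply: sieve_invS inv' => v [[sv av] lv].
    have [?|?] := leqP l2 (lifespan D v t); first by left; split.
    by right; split=> //; apply/andP.
  + rewrite !inE => /orP[/eqP->|jH].
      have [B [c [cert cg gB]]] := gaps l2 l2H; exists B, c; split=> //.
        exact: le_trans cg le'.
      apply: subset_trans gB => v [lv vl vi]; split; rewrite -?live'//.
        exact: ltn_trans ll2.
      move=> i iH il2; have [li|il] := ltnP l i.
        by have := l2_min i iH li; rewrite leqNgt il2.
      apply: vi; first by rewrite idx' !inE iH orbT.
      by rewrite ltn_neqAle il andbT; apply: contraNneq lH => <-.
    have [B [c [cert cg gB]]] := gaps j jH; exists B, c; split=> //.
      by rewrite /g old.
    exact: subset_trans gB.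
- have max_l j : j \in idx H -> (j <= l)%N.
    move=> jH; rewrite leqNgt; apply/negP => lj; apply: nsucc.
    exact: is_succ_exists lj.
  have inst_l := new_max max_l.
  split=> //; last by rewrite idx' !inE eqxx.
  split=> [i|v|i|j]; rewrite ?idx' ?live' ?from'.
  + by rewrite !inE => /orP[/eqP->//|/pos].
  + by move=> /bnd[j jH ?]; exists j; rewrite // !inE jH orbT.
  + rewrite !inE => /orP[/eqP->|iH]; last by rewrite old//; exact: insts.
    by rewrite inst_l no_live//; exact: empty_sieve_inv.
  + rewrite !inE => /orP[/eqP->|jH].
      exists set0, 0; split; first exact: certifies_set0.
        by rewrite mulr0; exact: f_ge0.
      (* The gap is empty: the lifespan of [v] is at most some old index [m < l], whereas [gap]
         requires it to exceed [m]. *)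
      move=> v [lv vl vi]; have [|m mH vm] := bnd v; first by rewrite -live'.
      have := vi m; rewrite idx' !inE mH orbT ltn_neqAle max_l// andbT.
      move=> /(_ isT).
      have -> : m != l by apply: contraNneq lH => <-.
      by move=> /(_ isT); rewrite ltnNge vm.
    have [B [c [cert cg gB]]] := gaps j jH; exists B, c; split=> //.
      by rewrite /g old.
    exact: subset_trans gB.
Qed.

(** As [l] is an index and [gap] demands lifespans strictly above all smaller indices, arrivals of
    lifespan [l] enter no gap. Certificates persist because values only grow. *)
Lemma feed_batch_inv t l H H' : l \in idx H -> hist_inv t H ->
  feed_batch f k eps D t l H H' ->
  hist_inv t H' /\ seen H' = seen H `|` arrivals D t l.
Proof.
move=> lH [pos bnd insts gaps] [idx' seen' fed unfed]; split=> //.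
have live' v : live H' t v -> live H t v \/ lifespan D v t = l.
  by rewrite /live seen' => -[[sv av|[]]]; [left|right].
have g_le i : i \in idx H -> g f H i <= g f H' i.
  move=> iH; have [il|li] := leqP i l; last by rewrite /g unfed.
  by have [] := feed_set_inv f_ge0 f_normalized f_monotone f_submodular
    k_ge1 eps01 (insts i iH) (fed i iH il).
split; rewrite idx' //.
- by move=> v /live'[/bnd//|vl]; exists l; rewrite ?vl.
- move=> i iH; have [il|li] := leqP i l; last first.
    rewrite unfed//; apply: sieve_invS (insts i iH) => v [/live'[//|vl] iv].
    by move: iv; rewrite vl leqNgt li.
  have [inv' _] := feed_set_inv f_ge0 f_normalized f_monotone f_submodular
    k_ge1 eps01 (insts i iH) (fed i iH il).
  apply: sieve_invS inv' => v [[sv av] iv].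
  by move: sv; rewrite seen' => -[sv|]; [left|right].
- move=> j jH; have [B [c [cert cg gB]]] := gaps j jH; exists B, c; split=> //.
    exact: le_trans cg (g_le j jH).
  apply: subset_trans gB => v [/live'[lv|vl] vj vi]; split=> //.
  + by move=> i iH; apply: vi; rewrite idx'.
  + by have := vi l; rewrite idx' lH -{1}vl vj vl ltnn => /(_ isT isT).
  + by move=> i iH; apply: vi; rewrite idx'.
Qed.

Lemma reachP H (X : {fset nat}) i : reach f eps H X i = 0%N \/
  [/\ reach f eps H X i \in X, (i < reach f eps H X i)%N &
      (1 - eps) * g f H i <= g f H (reach f eps H X i)].
Proof.
rewrite /reach big_seq_cond.
elim/big_ind: _ => [|x y Kx Ky|j /and3P[jX ij gj]]; [by left| |by right].
by rewrite /maxn; case: ifP.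
Qed.

(** Only the gap of the index reached from [i] can grow. Its predecessor is then [i], whose instance
    has processed that whole gap and supplies the new certificate. *)
Lemma prune_inv t H (X : {fset nat}) i :
  hist_inv t (Hist X (inst H) (seen H)) ->
  hist_inv t (Hist (prune f eps H X i) (inst H) (seen H)).
Proof.
rewrite /prune; case: ifP => // iX inv; have [pos bnd insts gaps] := inv.
set r := reach f eps H X i; have [r0|[rX ir gr]] := reachP H X i.
  (* With the default value 0 of [reach], no index lies in the deleted interval. *)
  suff -> : [fset l in X | ~~ (i < l < r)%N]%fset = X by [].
  by apply/fsetP => l; rewrite !inE /r r0 ltn0 andbF andbT.
split=> /= [j|v lv|j|j]; rewrite ?inE /=.
- by move=> /andP[/pos].
- have [j /= jX vj] := bnd v lv; have [/andP[ij jr]|nij] := boolP (i < j < r)%N.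
    by exists r; rewrite ?inE /= ?rX ?ltnn ?andbF// (leq_trans vj)// ltnW.
  by exists j; rewrite ?inE /= ?jX.
- by move=> /andP[/insts].
- move=> /andP[jX nij]; have [->|jr] := eqVneq j r.
    exists (live_from H t i), (g f H i); split=> //.
      exact: sieve_inv_certifies (insts i iX).
    move=> v [lv vr vi]; split=> //; apply/ltnW/vi => //=.
    by rewrite !inE /= iX ltnn.
  have [B [c [cert cg gB]]] := gaps j jX; exists B, c; split=> //.
  apply: subset_trans gB => v [lv vj vi]; split=> // m /= mX mj.
  have [/andP[im mr]|nim] := boolP (i < m < r)%N; last first.
    by apply: vi => //=; rewrite !inE /= mX.
  (* A deleted [m] below the surviving [j] forces [r < j], and the condition imposed by [r] on the
     gap of [j] implies the one lost with [m]. *)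
  have rj : (r < j)%N.
    by move: nij jr im mr; lia.
  by apply: ltn_trans mr _; apply: vi => //=; rewrite !inE /= rX ltnn andbF.
Qed.

Lemma process_inv t l H H' : (0 < l)%N -> hist_inv t H ->
  process f k eps D t l H H' ->
  hist_inv t H' /\ seen H' = seen H `|` arrivals D t l.
Proof.
move=> l0 inv [H1 [H2 [crH1 fdH2 [s _ ->]]]] /=.
have [inv1 lH1 seen1] := create_index_inv l0 inv crH1.
have [inv2 seen2] := feed_batch_inv lH1 inv1 fdH2.
split; last by rewrite seen2 seen1.
have : hist_inv t (Hist (idx H2) (inst H2) (seen H2)) by case: (H2) inv2.
by elim: s (idx H2) => //= i s IHs X invX; apply/IHs/prune_inv.
Qed.

Lemma data_update_inv t H H' : hist_inv t H ->
  data_update f k eps D t H H' ->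
  hist_inv t H' /\ seen H' = seen H `|` [set v | arrival D v = t].
Proof.
move=> inv [ls [_ ls_arr run]].
have ls_gt0 l : l \in ls -> (0 < l)%N.
  move=> /ls_arr[v [vt <-]].
  by rewrite /lifespan vt subnn subn0 init_lifespan_gt0.
suff [inv' seen'] : hist_inv t H' /\
    seen H' = seen H `|` [set v | arrival D v = t /\ lifespan D v t \in ls].
  split=> //; rewrite seen'; congr (_ `|` _); apply/seteqP; split=> v /=.
    by case.
  by move=> vt; split=> //; apply/ls_arr; exists v.
elim: ls ls_gt0 H inv run {ls_arr} => [|l ls IHs] ls_gt0 H inv /=.
  move=> ->; split=> //; apply/seteqP; split=> v; first by left.
  by case=> // -[].
move=> [H1 pr run].
have [inv1 seen1] := process_inv (ls_gt0 l (mem_head _ _)) inv pr.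
have [|inv' seen'] := IHs _ H1 inv1 run.
  by move=> m ms; apply: ls_gt0; rewrite inE ms orbT.
split=> //; rewrite seen' seen1 -setUA; congr (_ `|` _).
apply/seteqP; split=> v /=; rewrite inE.
  by case=> -[vt]; [move=> ->; rewrite eqxx|move=> ->; rewrite orbT].
by case=> vt /orP[/eqP|]; [left|right].
Qed.

(** Positivity at [t.+1] rules out truncation in the subtraction. *)
Lemma lifespanS v t : (arrival D v <= t)%N -> (0 < lifespan D v t.+1)%N ->
  lifespan D v t = (lifespan D v t.+1).+1.
Proof. by rewrite /lifespan; lia. Qed.

(** Index 1 disappears together with the elements of lifespan 1; the other indices and the remaining
    lifespans decrease in step. *)
Lemma time_update_inv t H : (forall v, seen H v -> (arrival D v <= t)%N) ->
  hist_inv t H -> hist_inv t.+1 (time_update H).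
Proof.
move=> past [pos bnd insts gaps].
have idxP j : reflect (0 < j /\ j.+1 \in idx H)%N (j \in idx (time_update H)).
  apply: (iffP (imfsetP _ _ _ _)) => /= [[x]|[j0 jH]].
    rewrite inE => /andP[xH x1] ->; have := pos x xH.
    by case: x xH x1 => [|[|x]].
  by exists j.+1; rewrite // inE jH /=; lia.
have live' v : live (time_update H) t.+1 v ->
    live H t v /\ lifespan D v t = (lifespan D v t.+1).+1.
  move=> [/= sv [_ v0]]; have vt := past v sv.
  have E := lifespanS vt v0; split=> //; split=> //; split=> //.
  by rewrite E.
split=> /=.
- by move=> i /idxP[].
- move=> v lv; have [lv' E] := live' v lv; have [j jH] := bnd v lv'.
  have [_ [_ v0]] := lv; rewrite E => vj; exists j.-1; last by lia.
  by apply/idxP; rewrite prednK; [split=> //; lia|lia].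
- move=> i /idxP[_ iH]; apply: sieve_invS (insts _ iH) => v [lv iv].
  by have [lv' E] := live' v lv; split=> //; rewrite E.
- move=> j /idxP[_ jH]; have [B [c [cert cg gB]]] := gaps _ jH.
  exists B, c; split=> //; apply: subset_trans gB => v [lv vj vi].
  have [lv' E] := live' v lv; have [_ [_ v0]] := lv.
  (* For the removed index 1, the condition of [gap] is just the survival of [v] to time [t.+1]. *)
  split=> //; rewrite ?E// => -[|[|i]] // iH ij.
  by rewrite ltnS; apply: vi => //; apply/idxP.
Qed.

(** The description of [seen] supplies the hypothesis of [time_update_inv] and makes every active
    element live. *)
Lemma hist_approx_inv t H : hist_approx f k eps D t H ->
  hist_inv t H /\ (forall v, seen H v <-> (arrival D v <= t)%N).
Proof.
elim=> {t H} [H upd|t H H' _ [inv seenH] upd].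
  have inv0 : hist_inv 1 init_hist by split=> // v [].
  have [inv seen'] := data_update_inv inv0 upd; split=> // v.
  rewrite seen' /=; have := arrival_gt0 D v; split=> [[//|->//]|]; right => /=.
  by lia.
have inv0 : hist_inv t.+1 (time_update H).
  by apply: time_update_inv => // v /seenH.
have [inv' seen'] := data_update_inv inv0 upd; split=> // v.
rewrite seen' leq_eqVlt ltnS; split=> [[/seenH ->|/= ->]|/orP[/eqP|/seenH]].
- by rewrite orbT.
- by rewrite eqxx.
- by right.
- by left.
Qed.

Lemma first_indexP H : idx H != fset0 ->
  first_index H \in idx H /\
  forall i, i \in idx H -> (first_index H <= i)%N.
Proof.
rewrite /first_index => X0; have := mem_sort leq (idx H).
have := sort_sorted leq_total (idx H).
case E : (sort leq (idx H)) => [|x s] /= srt mem_srt.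
  have /fset0Pn[i] := X0; by rewrite -mem_srt.
split=> [|i]; first by rewrite -mem_srt mem_head.
rewrite -mem_srt inE => /orP[/eqP->//|].
by move: srt; rewrite (path_sortedE leq_trans) => /andP[/allP/(_ i)].
Qed.

End HistInvariant.

(** * The approximation ratio from two certificates *)

Lemma certified_bound (R : realType) (V : choiceType) (f : set V -> R) (k : nat)
    (eps : R) (B1 B2 : set V) (c1 c2 c : R) (O : {fset V}) :
    (forall S, 0 <= f S) -> normalized f -> monotone f -> submodular f ->
    (1 <= k)%N -> 0 < eps < 1 ->
    certifies f k eps B1 c1 -> certifies f k eps B2 c2 ->
    c1 <= c -> (1 - eps) * c2 <= c -> 0 <= c ->
    (#|` O| <= k)%N -> [set` O] `<=` B1 `|` B2 ->
  (1 / 3 - eps) * f [set` O] <= c.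
Proof.
move=> f_ge0 f0 fmono fsub k1 /andP[e0 e1] cert1 cert2 c1c c2c c0 Ok OB.
have [F0|F0] := eqVneq (f [set` O]) 0; first by rewrite F0 mulr0.
have {}F0 : 0 < f [set` O] by rewrite lt_def F0 f_ge0.
have kR : 0 < k%:R :> R by rewrite ltr0n.
have y0 : 0 < f [set` O] / (3 * k%:R) by rewrite divr_gt0// mulr_gt0.
(* With [F] and [th] as named below, this gives [k * th <= F / 3 < (1 + eps) * k * th]. *)
have [i /andP[]] := @exprz_bracket R (1 + eps) _ ltac:(lra) y0.
rewrite -/(threshold eps i) ler_pdivlMr ?mulr_gt0// ltr_pdivrMr ?mulr_gt0//.
set th := threshold eps i; set F := f [set` O] in F0 *.
move=> thF Fth; have th0 : 0 < th by rewrite exprz_gt0//; lra.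
have K0 : 0 < k%:R * th by rewrite mulr_gt0.
(* Since [F / 3 < (1 + eps) * k * th], this rests on [(1 - 3 * eps) * (1 + eps) <= 1 - eps]; for
   [eps >= 1 / 3] the left side of the conclusion is at most 0. *)
have filled : (1 - eps) * (k%:R * th) <= c -> (1 / 3 - eps) * F <= c by nra.
have [cK|[C1 fC1 gain1]] := cert1 i.
  by apply: filled; rewrite -/th in cK; nra.
have [cK|[C2 fC2 gain2]] := cert2 i.
  by apply: filled; rewrite -/th in cK; nra.
(* By [k * th <= F / 3] this leaves [2 / 3 * F <= c + c / (1 - eps)]; conclude by [(1 / 3 - eps) *
   (2 - eps) <= 2 / 3 * (1 - eps)]. *)
suff : F <= c1 + c2 + k%:R * th by nra.
have C12 := subadditive_seq f0 fmono fsub [set` C1] (C2 : seq V).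
have gainO v : v \in (O : seq V) -> gain f v ([set` C1] `|` [set` C2]) <= th.
  by move=> /OB[/gain1|/gain2]; apply: le_trans; apply: gain_anti.
have := le_sum_gains fmono fsub gainO.
have : F <= f ([set` C1] `|` [set` C2] `|` [set` (O : seq V)]).
  by apply: fmono => x; right.
have : (size (O : seq V))%:R * th <= k%:R * th by rewrite ler_pM2r// ler_nat.
lra.
Qed.

Theorem theorem3 (R : realType) (V : choiceType) (f : set V -> R) (k : nat)
    (eps : R) (D : stream V)
    (f_ge0 : forall S : set V, (0 <= f S)%R)
    (f_normalized : normalized f) (f_monotone : monotone f)
    (f_submodular : submodular f)
    (k_ge1 : (1 <= k)%N) (eps01 : (0 < eps < 1)%R)
    (t : nat) (H : hist) (run : hist_approx f k eps D t H) :
  ((1 / 3%:R - eps) * OPT f k D t <= output_value f H)%R.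
Proof.
have [[_ bnd insts gaps] seenH] :=
  hist_approx_inv f_ge0 f_normalized f_monotone f_submodular k_ge1 eps01 run.
have [[O [OA Ok] ->] _] := OPT_max f k D t.
have live_active v : active D t v -> live D H t v.
  by move=> av; split=> //; apply/seenH; case: av.
rewrite /output_value; have [X0|X0] := eqVneq (idx H) fset0.
  (* Without indices, [live_bounded] leaves no active element. *)
  suff -> : [set` O] = set0 by rewrite f_normalized mulr0.
  by rewrite -subset0 => v /OA/live_active/bnd[j]; rewrite X0 inE.
have [xH x_min] := first_indexP X0; set x := first_index H in xH x_min *.
have [B [c [cert cg gB]]] := gaps x xH.
have cert_x := sieve_inv_certifies f_ge0 k_ge1 eps01 (insts x xH).
apply: (certified_bound f_ge0 f_normalized f_monotone f_submodular k_ge1 eps01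
  cert_x cert (lexx _) cg (f_ge0 _) Ok) => v /OA/live_active lv.
have [xv|vx] := leqP x (lifespan D v t); first by left.
(* No index is smaller than [x], so the last condition of [gap] is vacuous. *)
by right; apply: gB; split=> // i /x_min xi ix; rewrite ltnNge xi in ix.
Qed.
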